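(* Let $G$ be a Lie group with Lie algebra $\mathfrak{g}$ acting transitively from the left on a manifold $\mathcal{M}$, with $H$ the isotropy subgroup of a point $o\in\mathcal{M}$, and let $\sigma$ be a Cartan gauge (left partial moving frame) with Darboux derivative $\omega_\sigma$. Let $y(t)\in\mathcal{M}$ be the solution of a differential equation $$y'(t)=\widetilde{F}(y(t)),\qquad y(0)=y_0,$$ where $\widetilde F$ is a vector field on $\mathcal M$. Let $\widetilde{f}=\sigma_*\circ\widetilde{F}\in\Gamma(G\times_H\mathfrak{g})$ be identified with $\overline{f}\in\Omega^0_H(G,\mathfrak{g})$. Then the development $\delta(t)$ of $y(t)$ with respect to $\sigma$ is given by $$\delta(t)=\overline{f}(\sigma(y(t))).$$
   Context: All maps are smooth. A Cartan gauge is a (local) section $\sigma$ of $\pi\colon G\to\mathcal{M}$, $g\mapsto g\cdot o$, i.e. $\sigma\colon U\subset\mathcal{M}\to G$ with $\pi\circ\sigma=\mathrm{Id}$ on an open set $U$; everything is considered on the domain of definition of $\sigma$. Its Darboux derivative is $\omega_\sigma:=\omega\circ d\sigma$, where $\omega$ is the left Maurer–Cartan form on $G$, $\omega(v)=TL_{g^{-1}}v$ for $v\in T_gG$. $G\times_H\mathfrak{g}:=(G\times\mathfrak{g})/\!\sim$, where $(g,v)\sim(gh,\operatorname{Ad}_{h^{-1}}v)$ for $h\in H$; the class of $(g,v)$ is written $g\times_H v$; it is a vector bundle over $\mathcal{M}$ via $g\times_H v\mapsto g\cdot o$, and $\Gamma(G\times_H\mathfrak{g})$ is its space of sections. The map $\sigma_*\colon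 T\mathcal{M}\to G\times_H\mathfrak{g}$ is $\sigma_*(v)=\sigma(u)\times_H\omega_\sigma(v)$ for $v\in T_u\mathcal{M}$. $\Omega^0_H(G,\mathfrak{g})$ is the space of smooth $x\colon G\to\mathfrak{g}$ with $x(gh)=\operatorname{Ad}_{h^{-1}}x(g)$ for all $g\in G,h\in H$. An element $x\in\Omega^0_H(G,\mathfrak{g})$ is identified with the section $X\in\Gamma(G\times_H\mathfrak{g})$ given by $X(u)=\sigma(u)\times_H x(\sigma(u))$ (this identification does not depend on the gauge $\sigma$). The development of a curve $t\mapsto y(t)\in\mathcal{M}$ with respect to $\sigma$ is the curve $\delta(t):=\omega_\sigma(y'(t))\in\mathfrak{g}$. *)

(* Defs.v *)
From HB Require Import structures.
From mathcomp Require Import all_boot all_order all_algebra.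
From mathcomp Require Import all_classical all_reals all_analysis.

Set Implicit Arguments.
Unset Strict Implicit.
Unset Printing Implicit Defensive.

Import Order.TTheory GRing.Theory Num.Theory.
Import numFieldNormedType.Exports.

Local Open Scope classical_set_scope.
Local Open Scope ring_scope.

(* f is C^k on A; meant for A open (the model spaces are finite dimensional,
   so all directional derivatives being C^(k-1) amounts to 'd f being so). *)
Fixpoint Ck_on (R : realType) (V W : normedModType R) (k : nat) (A : set V)
    (f : V -> W) : Prop :=
  match k with
  | 0%N => forall x, A x -> {for x, continuous f}
  | k'.+1 => (forall x, A x -> differentiable f x) /\
             (forall v : V, Ck_on k' A (fun x => 'D_v f x))
  end.

Definition smooth_on (R : realType) (V W : normedModType R) (A : set V)
    (f : V -> W) : Prop :=
  forall k, Ck_on k A f.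

(* chart_to and chart_inv are total functions, but only their restrictions to
   chart_dom and chart_cod are meaningful. *)
Record chart (R : realType) (n : nat) (T : topologicalType) := Chart {
  chart_dom : set T;
  chart_cod : set 'rV[R]_n;
  chart_to :> T -> 'rV[R]_n;
  chart_inv : 'rV[R]_n -> T;
  chart_dom_open : open chart_dom;
  chart_cod_open : open chart_cod;
  chart_toP : forall p, chart_dom p -> chart_cod (chart_to p);
  chart_invP : forall x, chart_cod x -> chart_dom (chart_inv x);
  chart_toK : forall p, chart_dom p -> chart_inv (chart_to p) = p;
  chart_invK : forall x, chart_cod x -> chart_to (chart_inv x) = x;
  chart_to_continuous : forall p, chart_dom p -> {for p, continuous chart_to};
  chart_inv_continuous : forall x, chart_cod x -> {for x, continuous chart_inv}
}.

(* Smooth n-manifolds. The preferred chart chart_at p around p exists for every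
   atlas; it is only used to represent tangent vectors at p by coordinates. *)
HB.mixin Record Topological_isManifold (R : realType) (n : nat) (M : Type)
    of Topological M := {
  atlas : set (chart R n M);
  chart_at : M -> chart R n M;
  chart_at_atlas : forall p, atlas (chart_at p);
  chart_at_dom : forall p, chart_dom (chart_at p) p;
  atlas_compatible : forall phi psi, atlas phi -> atlas psi ->
    smooth_on (chart_cod phi `&` chart_inv phi @^-1` chart_dom psi)
      (psi \o chart_inv phi);
  manifold_hausdorff : hausdorff_space M;
  manifold_second_countable : @second_countable M
}.

#[short(type="manifoldType")]
HB.structure Definition Manifold (R : realType) (n : nat) :=
  {M of Topological M & Topological_isManifold R n M}.

Section smooth_maps.
Variable R : realType.

Definition smooth_into (V : normedModType R) n (N : manifoldType R n)
    (A : set V) (f : V -> N) : Prop :=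
  (forall x, A x -> {for x, continuous f}) /\
  (forall psi : chart R n N, atlas psi ->
     smooth_on (A `&` f @^-1` chart_dom psi) (psi \o f)).

Definition smooth_map m n (M : manifoldType R m) (N : manifoldType R n)
    (U : set M) (f : M -> N) : Prop :=
  forall phi : chart R m M, atlas phi ->
    smooth_into (chart_cod phi `&` chart_inv phi @^-1` U) (f \o chart_inv phi).

(* Smoothness of f as a map on the product manifold M * N, in product charts. *)
Definition smooth_map2 m n p (M : manifoldType R m) (N : manifoldType R n)
    (P : manifoldType R p) (f : M -> N -> P) : Prop :=
  forall (phi : chart R m M) (psi : chart R n N), atlas phi -> atlas psi ->
    smooth_into (chart_cod phi `*` chart_cod psi)
      (fun z : 'rV[R]_m * 'rV[R]_n => f (chart_inv phi z.1) (chart_inv psi z.2)).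

Definition smooth_fun m (M : manifoldType R m) (W : normedModType R)
    (U : set M) (f : M -> W) : Prop :=
  forall phi : chart R m M, atlas phi ->
    smooth_on (chart_cod phi `&` chart_inv phi @^-1` U) (f \o chart_inv phi).

End smooth_maps.

(* T_p M is the space of coordinate vectors with respect to chart_at p. *)
Definition tangent (R : realType) n (M : manifoldType R n) (p : M) : Type :=
  'rV[R]_n.

HB.instance Definition _ (R : realType) n (M : manifoldType R n) (p : M) :=
  NormedModule.copy (tangent p) 'rV[R]_n.

(* The map T_p M -> T_(f p) N, expressed in the preferred charts at p and f p. *)
Definition differential (R : realType) m n (M : manifoldType R m)
    (N : manifoldType R n) (f : M -> N) (p : M) (v : tangent p) :
    tangent (f p) :=
  'd (chart_at (f p) \o f \o chart_inv (chart_at p)) (chart_at p p) v.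

Arguments differential {R m n M N} f p v.

(* Coordinates of v in an arbitrary chart phi around p. *)
Definition tangent_coord (R : realType) m (M : manifoldType R m)
    (phi : chart R m M) (p : M) (v : tangent p) : 'rV[R]_m :=
  'd (phi \o chart_inv (chart_at p)) (chart_at p p) v.

Arguments tangent_coord {R m M} phi p v.

Definition smooth_vector_field (R : realType) m (M : manifoldType R m)
    (X : forall p : M, tangent p) : Prop :=
  forall phi : chart R m M, atlas phi ->
    smooth_fun (chart_dom phi) (fun p => tangent_coord phi p (X p)).

Definition velocity (R : realType) m (M : manifoldType R m) (y : R -> M)
    (t : R) : tangent (y t) :=
  derive1 (chart_at (y t) \o y) t.

Definition integral_curve (R : realType) m (M : manifoldType R m)
    (X : forall p : M, tangent p) (J : set R) (y : R -> M) : Prop :=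
  smooth_into J y /\ (forall t, J t -> velocity y t = X (y t)).

HB.mixin Record Manifold_Group_isLieGroup (R : realType) (n : nat) (G : Type)
    of Manifold R n G & Group G := {
  mulg_smooth : smooth_map2 (fun g h : G => (g * h)%g);
  invg_smooth : smooth_map setT (fun g : G => (g^-1)%g)
}.

#[short(type="lieGroupType")]
HB.structure Definition LieGroup (R : realType) (n : nat) :=
  {G of Manifold R n G & Group G & Manifold_Group_isLieGroup R n G}.

Definition lie_algebra (R : realType) n (G : lieGroupType R n) : Type :=
  tangent (1%g : G).

HB.instance Definition _ (R : realType) n (G : lieGroupType R n) :=
  NormedModule.copy (lie_algebra G) 'rV[R]_n.

(* The value lies in the tangent space at h * 1 * h^-1 = 1. *)
Definition Ad (R : realType) n (G : lieGroupType R n) (h : G)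
    (v : lie_algebra G) : lie_algebra G :=
  differential (fun g : G => (h * g * h^-1)%g) 1%g v.

(* The value lies in the tangent space at g^-1 * g = 1. *)
Definition maurer_cartan (R : realType) n (G : lieGroupType R n) (g : G)
    (v : tangent g) : lie_algebra G :=
  differential (fun k : G => (g^-1 * k)%g) g v.

Arguments maurer_cartan {R n G} g v.

Definition darboux (R : realType) n (G : lieGroupType R n) m
    (M : manifoldType R m) (sigma : M -> G) (u : M) (v : tangent u) :
    lie_algebra G :=
  maurer_cartan (sigma u) (differential sigma u v).

Arguments darboux {R n G m M} sigma u v.

Definition development (R : realType) n (G : lieGroupType R n) m
    (M : manifoldType R m) (sigma : M -> G) (y : R -> M) (t : R) :
    lie_algebra G :=
  darboux sigma (y t) (velocity y t).

Section associated_bundle.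
Variables (R : realType) (n : nat) (G : lieGroupType R n).

Definition assoc_class (H : set G) (p : G * lie_algebra G) :
    set (G * lie_algebra G) :=
  [set q | exists2 h, H h & q = ((p.1 * h)%g, Ad (h^-1)%g p.2)].

(* G *_H g, as the set of equivalence classes (which are H-orbits). *)
Record assoc_bundle (H : set G) := AssocBundle {
  assoc_carrier : set (G * lie_algebra G);
  assoc_carrierP : exists p, assoc_carrier = assoc_class H p
}.

Definition assoc_pair (H : set G) (g : G) (v : lie_algebra G) : assoc_bundle H :=
  AssocBundle (ex_intro _ (g, v) erefl).

(* Omega^0_H(G, g), restricted to a right H-stable open subset W of G. *)
Definition equivariant_on (H W : set G) (x : G -> lie_algebra G) : Prop :=
  smooth_fun W x /\
  (forall g h, W g -> H h -> x (g * h)%g = Ad (h^-1)%g (x g)).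

End associated_bundle.

Section homogeneous_space.
Variables (R : realType) (n m : nat).
Variables (G : lieGroupType R n) (M : manifoldType R m).

Definition smooth_transitive_action (act : G -> M -> M) : Prop :=
  [/\ smooth_map2 act,
      (forall u, act 1%g u = u),
      (forall g h u, act (g * h)%g u = act g (act h u)) &
      (forall u v, exists g, act g u = v)].

Variables (act : G -> M -> M) (o : M).

Definition isotropy : set G := [set h | act h o = o].

Definition orbit_map (g : G) : M := act g o.

Definition cartan_gauge (U : set M) (sigma : M -> G) : Prop :=
  [/\ open U, smooth_map U sigma & forall u, U u -> orbit_map (sigma u) = u].

Definition sigma_star (sigma : M -> G) (u : M) (v : tangent u) :
    assoc_bundle isotropy :=
  assoc_pair isotropy (sigma u) (darboux sigma u v).

(* Smooth sections over U; smoothness is tested in the local trivializations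
   (u, v) |-> s u *_H v of the bundle given by the gauges s. *)
Definition assoc_section (U : set M) (X : M -> assoc_bundle isotropy) : Prop :=
  (forall u, U u ->
     exists g v, X u = assoc_pair isotropy g v /\ orbit_map g = u) /\
  (forall (V : set M) (s : M -> G), V `<=` U -> cartan_gauge V s ->
     exists2 x : M -> lie_algebra G, smooth_fun V x &
       forall u, V u -> X u = assoc_pair isotropy (s u) (x u)).

(* Here x lives over U, that is, on the preimage of U under orbit_map. *)
Definition identified_with (U : set M) (sigma : M -> G)
    (X : M -> assoc_bundle isotropy) (x : G -> lie_algebra G) : Prop :=
  [/\ assoc_section U X,
      equivariant_on isotropy (orbit_map @^-1` U) x &
      forall u, U u -> X u = assoc_pair isotropy (sigma u) (x (sigma u))].

End homogeneous_space.

Arguments sigma_star {R n m G M} act o sigma u v.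

(* Main.v *)
Require Import Defs.
From HB Require Import structures.
From mathcomp Require Import all_boot all_order all_algebra.
From mathcomp Require Import all_classical all_reals all_analysis.

Set Implicit Arguments.
Unset Strict Implicit.
Unset Printing Implicit Defensive.

Import GRing.Theory numFieldNormedType.Exports.
Local Open Scope classical_set_scope.
Local Open Scope ring_scope.

(** Since [y] is an integral curve of [F], its development at [t] is [darboux sigma u (F u)] with
    [u = y t]. The bundle element [sigma_star] at [u] thus has two representatives over [sigma u]:
    this vector, by definition, and [fbar (sigma u)], by the identification. They agree because a
    class has at most one representative over a given group element ([assoc_pair_inj]), which rests
    on [Ad 1] being the identity ([Ad1]). *)

(** Near [x] both maps have the same first-order remainder, so uniqueness of the differential
    applies. *)
Lemma near_eq_diff (K : numFieldType) (V W : normedModType K) (f g : V -> W)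
    (x : V) :
  {near x, f =1 g} -> differentiable g x -> 'd f x = 'd g x :> (V -> W).
Proof.
move=> fg dg; apply: diff_unique; first exact: diff_continuous.
apply/eqaddoP => e e0; have /eqaddoP/(_ e e0) := diff_locally dg.
have : \forall h \near 0, f (h + x) = g (h + x).
  by move: fg; rewrite (near_shift 0 x); apply: filterS => h /=; rewrite subr0.
apply: filterS2 => h fgh.
by rewrite /= !fctE /= fgh (nbhs_singleton fg).
Qed.

(** In the chart the map reads [phi \o chart_inv phi], which is known to be the identity only on the
    open set [chart_cod phi]; hence the need for a local argument. *)
Lemma differential_id (R : realType) (n : nat) (N : manifoldType R n) (p : N)
    (v : tangent p) : differential (fun q : N => q) p v = v.
Proof.
rewrite /differential; set phi := chart_at p.
have phip : chart_cod phi (phi p) := chart_toP (chart_at_dom p).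
have phiK : {near phi p, phi \o (fun q : N => q) \o chart_inv phi =1 id}.
  have := open_nbhs_nbhs (conj (@chart_cod_open _ _ _ phi) phip).
  by apply: filterS => x /chart_invK.
by rewrite (near_eq_diff phiK) ?diff_val.
Qed.

Lemma Ad1 (R : realType) (n : nat) (G : lieGroupType R n) (v : lie_algebra G) :
  Ad 1%g v = v.
Proof.
rewrite -[RHS](@differential_id R n G 1%g) /Ad.
(* Replacing the whole function also turns the base point [1 * 1 * 1^-1] of the target chart into
   [1]. *)
suff -> : (fun g : G => 1 * g * 1^-1)%g = id by [].
by apply/funext => g; rewrite mul1g invg1 mulg1.
Qed.

(* H acts freely on G, so the element of H relating (g, v) to (g, w) is 1. *)
Lemma assoc_pair_inj (R : realType) (n : nat) (G : lieGroupType R n)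
    (H : set G) (g : G) : H 1%g -> injective (@assoc_pair R n G H g).
Proof.
move=> H1 v w [] vw.
(* [vw] equates two orbits as sets; [(g, v)] lies in its own, through [h = 1], hence in the
   other. *)
have : assoc_class H (g, w) (g, v).
  by rewrite -vw; exists 1%g => //=; rewrite mulg1 invg1 Ad1.
case=> h _ [] /= /esym gh ->.
have -> : h = 1%g by apply: (mulgI g); rewrite mulg1.
by rewrite invg1 Ad1.
Qed.

Theorem proposition4p2 (R : realType) (n m : nat)
    (G : lieGroupType R n) (M : manifoldType R m)
    (act : G -> M -> M) (act_trans : smooth_transitive_action act) (o : M)
    (U : set M) (sigma : M -> G) (gauge : cartan_gauge act o U sigma)
    (F : forall u : M, tangent u) (F_smooth : smooth_vector_field F)
    (J : set R) (J_open : open J) (J_itv : is_interval J) (J0 : J 0)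
    (y0 : M) (y : R -> M) (y_sol : integral_curve F J y) (y_init : y 0 = y0)
    (fbar : G -> lie_algebra G)
    (f_fbar : identified_with U sigma (fun u => sigma_star act o sigma u (F u)) fbar) :
  forall t, J t -> U (y t) -> development sigma y t = fbar (sigma (y t)).
Proof.
move=> t Jt Uyt.
have [_ yF] := y_sol; have [_ _ fbarE] := f_fbar.
have [_ act1 _ _] := act_trans.
rewrite /development (yF t Jt).
(* [act1 o] says that 1 fixes [o], so that it lies in the isotropy group. *)
exact: (assoc_pair_inj (act1 o) (fbarE _ Uyt)).
Qed.
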